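(* For every real number $N$ there exist a graph $G$, a subgraph $H$ of $G$, and a vertex $u \in V(H) \subseteq V(G)$ such that for every positive integer $d$, $$f_d(H,u) - f_d(G,u) \ge N \quad\text{and}\quad \frac{f_d(H,u)}{f_d(G,u)} \ge N.$$
   Context: Graphs are simple and undirected and may be infinite. Distance-$d$ (distance-restricted) firefighter game on a graph $G$ with $k$ firefighters and fire at $u$: on turn $0$, the vertex $u$ starts burning, and then the $k$ firefighters are placed on unburnt vertices (several may occupy the same vertex), protecting the vertices they occupy. On each turn $t+1$ ($t\ge 0$), first the fire spreads to every unburnt, unprotected neighbour of every burning vertex; then each firefighter moves from its current vertex to an unburnt vertex at distance at most $d$ (possibly staying put, and several may occupy the same vertex), where the distance is measured in the subgraph of $G$ induced by the currently unburnt vertices (firefighters may not move through the fire), and protects the vertex it arrives at. Once a vertex is burning or protected it remains so for the rest of the game. The fire is contained if after finitely many turns a point is reached where the fire can no longer spread (no burning vertex has an unburnt, unprotected neighbour). $f_d(G,u)$ is the minimum number $k$ of firefighters for which a fire breaking out at $u$ can be contained in this game on $G$. *)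

(* Defs.v *)
From mathcomp Require Import all_boot all_order all_algebra.
From mathcomp Require Import classical_sets reals.

Set Implicit Arguments.
Unset Strict Implicit.
Unset Printing Implicit Defensive.

Local Open Scope classical_set_scope.

(* The vertex set is a subset of an ambient type, so that a graph and its
   subgraphs share vertices without coercions. *)
Record graph (T : Type) := Graph {
  vertices : set T;
  adj : T -> T -> Prop;
  adj_vertex : forall x y, adj x y -> vertices x;
  adj_sym : forall x y, adj x y -> adj y x;
  adj_irrefl : forall x, ~ adj x x }.

Definition subgraph (T : Type) (H G : graph T) : Prop :=
  vertices H `<=` vertices G /\ (forall x y, adj H x y -> adj G x y).

Section Induced.
Context (T : Type) (G : graph T) (A : set T).

Definition induced_vertices : set T := vertices G `&` A.
Definition induced_adj (x y : T) : Prop := [/\ adj G x y, A x & A y].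

Fact induced_adj_vertex x y : induced_adj x y -> induced_vertices x.
Proof. by move=> [Gxy Ax _]; split=> //; exact: adj_vertex Gxy. Qed.

Fact induced_adj_sym x y : induced_adj x y -> induced_adj y x.
Proof. by move=> [Gxy Ax Ay]; split=> //; exact: adj_sym. Qed.

Fact induced_adj_irrefl x : ~ induced_adj x x.
Proof. by move=> [Gxx _ _]; exact: adj_irrefl Gxx. Qed.

Definition induced : graph T :=
  Graph induced_adj_vertex induced_adj_sym induced_adj_irrefl.

End Induced.

Inductive walk (T : Type) (G : graph T) : nat -> T -> T -> Prop :=
| walk_nil x : vertices G x -> walk G 0 x x
| walk_cons n x y z : adj G x y -> walk G n y z -> walk G n.+1 x z.

Definition is_least (P : nat -> Prop) (n : nat) : Prop :=
  P n /\ (forall m, P m -> n <= m).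

(* No n satisfies this when x and y lie in different components. *)
Definition is_dist (T : Type) (G : graph T) (x y : T) (n : nat) : Prop :=
  is_least (fun m => walk G m x y) n.

Section Firefighter.
Context (T : Type) (G : graph T) (d : nat) (u : T) (k : nat).

(* The fire is deterministic, so a strategy is the sequence of positions:
   p t i is the vertex occupied by firefighter i at the end of turn t. *)
Implicit Type p : nat -> 'I_k -> T.

Definition protected p (t : nat) : set T :=
  [set v | exists s i, s <= t /\ p s i = v].

Fixpoint burning p (t : nat) : set T :=
  if t is t'.+1 then
    burning p t' `|`
    [set v | [/\ ~ burning p t' v, ~ protected p t' v
               & exists2 w, burning p t' w & adj G w v]]
  else [set u].

Definition unburnt p (t : nat) : set T := vertices G `\` burning p t.

Definition legal p : Prop :=
  (forall i, unburnt p 0 (p 0 i)) /\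
  (forall t i, unburnt p t.+1 (p t.+1 i) /\
     exists2 n, n <= d &
       is_dist (induced G (unburnt p t.+1)) (p t i) (p t.+1 i) n).

Definition contained_at p (t : nat) : Prop :=
  ~ exists w v, [/\ burning p t w, adj G w v, unburnt p t v
                  & ~ protected p t v].

Definition can_contain : Prop :=
  exists p, legal p /\ exists t, contained_at p t.

End Firefighter.

(* f_d(G, u) = k; no k satisfies this if no finite number of firefighters
   suffices. *)
Definition firefighter_number (T : Type) (G : graph T) (d : nat) (u : T)
    (k : nat) : Prop :=
  is_least (can_contain G d u) k.

(* Main.v *)
Require Import Defs.
From mathcomp Require Import all_boot all_order all_algebra.
From mathcomp Require Import classical_sets reals.

(* H is a spider: m + 1 infinite legs attached to u.  Once u burns, no
   firefighter can change legs whatever d is, so every leg needs its own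
   firefighter and f_d(H,u) = m + 1.  G adds a clique on the vertices at
   distance m + 1 from u; a single firefighter walks through this clique, one
   leg per turn, and has protected all of it before the fire arrives, so
   f_d(G,u) = 1. *)

Import Order.TTheory GRing.Theory Num.Theory.

(** * The spider and the web *)

(* [None] is the body u and [Some (i, a)] the vertex of leg i at distance
   a + 1 from u. *)
Definition spider_vertex (m : nat) : Type := option ('I_m.+1 * nat).

Definition depth {m} (x : spider_vertex m) : nat :=
  if x is Some (_, a) then a.+1 else 0.

Definition leg_arc {m} (x y : spider_vertex m) : bool :=
  match x, y with
  | None, Some (_, b) => b == 0
  | Some (i, a), Some (j, b) => (i == j) && (b == a.+1)
  | _, _ => false
  end.

Definition spider_adj {m} (x y : spider_vertex m) : Prop :=
  leg_arc x y || leg_arc y x.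

Definition rung {m} (x y : spider_vertex m) : bool :=
  match x, y with
  | Some (i, a), Some (j, b) => [&& i != j, a == m & b == m]
  | _, _ => false
  end.

Definition web_adj {m} (x y : spider_vertex m) : Prop :=
  spider_adj x y \/ rung x y.

Lemma leg_arc_depth m (x y : spider_vertex m) :
  leg_arc x y -> depth y = (depth x).+1.
Proof.
by case: x y => [[i a]|] [[j b]|] //= => [/andP[_]|] /eqP ->.
Qed.

Lemma spider_adj_sym m (x y : spider_vertex m) :
  spider_adj x y -> spider_adj y x.
Proof. by rewrite /spider_adj orbC. Qed.

Lemma spider_adj_irrefl m (x : spider_vertex m) : ~ spider_adj x x.
Proof.
by case/orP=> /leg_arc_depth /eqP; rewrite eqn_leq ltnn andbF.
Qed.

Lemma web_adj_sym m (x y : spider_vertex m) : web_adj x y -> web_adj y x.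
Proof.
case=> [/spider_adj_sym|]; first by left.
by case: x y => [[i a]|] [[j b]|] //= /and3P[ij am bm]; right;
  rewrite /= eq_sym ij am bm.
Qed.

Lemma web_adj_irrefl m (x : spider_vertex m) : ~ web_adj x x.
Proof.
case=> [/spider_adj_irrefl //|].
by case: x => [[i a]|] //=; rewrite eqxx.
Qed.

Definition spider (m : nat) : graph (spider_vertex m) :=
  @Graph _ setT (@spider_adj m) (fun _ _ _ => I) (@spider_adj_sym m)
    (@spider_adj_irrefl m).

Definition web (m : nat) : graph (spider_vertex m) :=
  @Graph _ setT (@web_adj m) (fun _ _ _ => I) (@web_adj_sym m)
    (@web_adj_irrefl m).

Lemma spider_subgraph_web m : subgraph (spider m) (web m).
Proof. by split=> // x y; left. Qed.

(** Rungs join vertices of equal depth, so they give the fire no shortcut outwards. *)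
Lemma web_adj_depth {m} {x y : spider_vertex m} :
  web_adj x y -> depth y <= (depth x).+1.
Proof.
case=> [/orP[] /leg_arc_depth ->|] //; first by rewrite ltnW // ltnW.
by case: x y => [[i a]|] [[j b]|] //= /and3P[_ /eqP -> /eqP ->].
Qed.

(** * Games on arbitrary graphs *)

Lemma is_dist0 {T} (g : graph T) x : vertices g x -> is_dist g x x 0.
Proof. by move=> gx; split=> //; exact: walk_nil. Qed.

Lemma is_dist1 {T} (g : graph T) x y : adj g x y -> is_dist g x y 1.
Proof.
move=> gxy; split.
  by apply: (walk_cons gxy); apply/walk_nil/adj_vertex/adj_sym/gxy.
by case=> // w; inversion w; subst; case: (adj_irrefl gxy).
Qed.

Section Games.
Context {T : Type} (g : graph T) (u : T) {k : nat} (p : nat -> 'I_k -> T).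

Lemma burning_mono {s t v} :
  s <= t -> burning g u p s v -> burning g u p t v.
Proof.
move=> /subnKC <-; elim: (t - s) => [|n IH] bv; first by rewrite addn0.
by rewrite addnS; left; exact: IH.
Qed.

Lemma burning_spread {t w v} :
  burning g u p t w -> adj g w v -> ~ protected p t v ->
  burning g u p t.+1 v.
Proof.
move=> bw gwv npv; have [bv|nbv] := boolp.pselect (burning g u p t v).
  by left.
by right; split=> //; exists w.
Qed.

(** An occupied vertex is protected, hence still unburnt after the next spread; staying or crossing
    one edge then costs distance 0 or 1, within any positive [d]. *)
Lemma legal_step d : 0 < d ->
  (forall t i, unburnt g u p t (p t i)) ->
  (forall t i, p t.+1 i = p t i \/ adj g (p t i) (p t.+1 i)) ->
  legal g d u p.
Proof.
move=> d0 safe step; split=> // t i; split=> //.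
have safe' : unburnt g u p t.+1 (p t i).
  have [gv nb] := safe t i; split=> // -[//|[_ + _]].
  by apply; exists t, i.
have [e|a] := step t i.
  exists 0 => //; rewrite e; apply: is_dist0.
  by case: safe' => gv nb; split.
by exists 1 => //; apply: is_dist1; split=> //; exact: safe.
Qed.

End Games.

(** * Fire on a graph between the spider and the web *)

Lemma spider_adj_body m (j : 'I_m.+1) : spider_adj None (Some (j, 0)).
Proof. by []. Qed.

Lemma spider_adj_leg m (j : 'I_m.+1) n :
  spider_adj (Some (j, n)) (Some (j, n.+1)).
Proof. by rewrite /spider_adj /= !eqxx. Qed.

Section Spread.
Context {m : nat} {g : graph (spider_vertex m)}.
Context (legs : subgraph (spider m) g) (inweb : subgraph g (web m)).
Context {k : nat} (p : nat -> 'I_k -> spider_vertex m).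

Lemma leg_vertex x : vertices g x.
Proof. by case: legs => + _; apply. Qed.

Lemma burning_depth {t v} : burning g None p t v -> depth v <= t.
Proof.
elim: t v => [|t IH] v /=; first by move=> ->.
case=> [/IH /leqW //|[_ _ [w /IH wt /inweb.2 /web_adj_depth]]].
by move=> /leq_trans; apply.
Qed.

(** The fire runs down an unguarded leg by one vertex per turn. Only the first [n.+1] vertices must
    stay free, so this also covers a leg of the web below its guarded rim. *)
Lemma leg_burning {j n} :
  (forall a t, a <= n -> ~ protected p t (Some (j, a))) ->
  burning g None p n.+1 (Some (j, n)).
Proof.
elim: n => [|n IH] free.
  apply: (@burning_spread _ _ _ _ _ _ None) => //; last exact: free.
  by apply/legs.2/spider_adj_body.
apply: (@burning_spread _ _ _ _ _ _ (Some (j, n))); last exact: free.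
  by apply: IH => a t an; apply: free; exact: leqW.
by apply/legs.2/spider_adj_leg.
Qed.

(** On turn [t] the fire has reached depth [t] on leg [j], and no vertex of depth [t.+1] burns
    yet. *)
Lemma free_leg_not_contained j t :
  (forall a s, ~ protected p s (Some (j, a))) ->
  ~ contained_at g None p t.
Proof.
move=> free; apply; case: t => [|n].
  exists None, (Some (j, 0)); split=> //.
    by apply/legs.2/spider_adj_body.
  by split; first exact: leg_vertex.
exists (Some (j, n)), (Some (j, n.+1)); split=> //.
- by apply: leg_burning => a s _; exact: free.
- by apply/legs.2/spider_adj_leg.
- by split=> [|/burning_depth]; [exact: leg_vertex|rewrite /= ltnn].
Qed.

End Spread.

(** * Firefighter number of the spider *)

Lemma subgraph_refl {T} (g : graph T) : subgraph g g.
Proof. by split. Qed.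

(** Removing the body disconnects the legs, so a walk of any length keeps its leg, read off by
    [omap fst]. *)
Lemma spider_walk_leg m (A : set (spider_vertex m)) n x y :
  ~ A None -> walk (induced (spider m) A) n x y ->
  omap fst x = omap fst y.
Proof.
move=> AN; elim=> // n1 x1 y1 z [xy Ax Ay] _ <-.
case: x1 y1 xy Ax Ay => [[i a]|] [[j b]|] //=.
by case/orP=> /andP[/eqP ->].
Qed.

Lemma spider_can_contain_gt m d k : can_contain (spider m) d None k -> m < k.
Proof.
move=> [p [[safe0 move_p] [t ct]]]; rewrite ltnNge; apply/negP => km.
have bN s : burning (spider m) None p s None.
  exact: (@burning_mono _ _ _ _ _ 0).
have leg s i : omap fst (p s i) = omap fst (p 0 i).
  elim: s => // s <-; have [[_ _] [n _ [w _]]] := move_p s i.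
  by symmetry; apply: spider_walk_leg w; case=> _; apply.
(* The default [ord0] is harmless: an image of ['I_k] has at most [k <= m] elements in any case, so
   one of the [m.+1] legs is missing. *)
pose occupied := [set odflt ord0 (omap fst (p 0 i)) | i : 'I_k].
have [j jfree] : exists j, j \notin occupied.
  apply/existsP; rewrite -negb_forall; apply/negP => /forallP full.
  have : #|'I_m.+1| <= #|occupied|.
    by apply/subset_leq_card/fintype.subsetP => j _; exact: full.
  rewrite card_ord => /leq_trans /(_ (leq_imset_card _ _)).
  by rewrite card_ord ltnNge km.
apply: (free_leg_not_contained (subgraph_refl _) (spider_subgraph_web m) p j t)
  ct => //.
move=> a s [s' [i [_ e]]]; move/negP: jfree; apply.
by apply/imsetP; exists i => //; rewrite -(leg s') e.
Qed.

(** One stationary firefighter next to the body on each leg confines the fire to the body. *)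
Lemma spider_can_contain m d : 0 < d -> can_contain (spider m) d None m.+1.
Proof.
move=> d0; pose p (t : nat) (i : 'I_m.+1) : spider_vertex m := Some (i, 0).
have only_body t v : burning (spider m) None p t v -> v = None.
  elim: t v => [|t IH] v //= [/IH //|[_ npv [w /IH -> ]]].
  case: v npv => [[i a]|] // npv; rewrite /spider_adj /= orbF => /eqP a0.
  by case: npv; exists 0, i; split=> //; rewrite a0.
exists p; split; last first.
  exists 0 => -[w [v [/= -> ]]].
  case: v => [[i a]|] //; rewrite /spider_adj /= orbF => /eqP -> _.
  by apply; exists 0, i.
by apply: legal_step => // t i; [split=> // /only_body|left].
Qed.

(** * Firefighter number of the web *)

Lemma web_can_contain m d : 0 < d -> can_contain (web m) d None 1.
Proof.
move=> d0.
(* The [minn] lets the firefighter rest on leg [m] once all legs are visited. *)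
pose p (t : nat) (_ : 'I_1) : spider_vertex m := Some (inord (minn t m), m).
have rim i t : m <= t -> protected p t (Some (i, m)).
  move=> mt; exists i, ord0; split; first by rewrite (leq_trans _ mt) // -ltnS.
  rewrite /p; congr (Some (_, m)); apply: val_inj.
  by rewrite /= (minn_idPl _) ?inordK // -ltnS.
have inside t v : burning (web m) None p t v -> depth v <= m.
  elim: t v => [|t IH] v; first by move=> /= ->.
  case=> [/IH //|[_ npv [w bw wv]]].
  have dw := IH _ bw; have dv := web_adj_depth wv.
  (* For [t < m] the speed bound suffices; from [m <= t] on, the whole rim is protected. *)
  case: (leqP m t) => mt; last first.
    apply: leq_trans dv (leq_ltn_trans _ mt).
    exact: (burning_depth (subgraph_refl (web m)) p).
  have /predU1P[vm|//] : (depth v == m.+1) || (depth v < m.+1).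
    by rewrite -leq_eqVlt (leq_trans dv).
  by case: v vm npv {wv dv} => [[i a]|] //= [->] []; exact: rim.
exists p; split; last first.
  (* By turn [m] every vertex of depth at most [m] burns, so only the protected rim borders the
     fire. *)
  exists m => -[w [v [bw wv [_ nbv] npv]]].
  have: depth v <= m.+1.
    by rewrite (leq_trans (web_adj_depth wv)) // ltnS (inside m).
  case: v nbv npv {wv} => [[i a]|] nbv npv /=; last first.
    by case: nbv; exact: (@burning_mono _ _ _ _ _ 0).
  rewrite ltnS leq_eqVlt => /predU1P[am|am].
    by case: npv; rewrite am; exact: rim.
  case: nbv; apply: (burning_mono _ _ _ am).
  apply: (leg_burning (spider_subgraph_web m) p) => b t ba [s [j [_ [_ mb]]]].
  by move: (leq_ltn_trans ba am); rewrite mb ltnn.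
apply: legal_step => // t i; first by split=> // /inside; rewrite /= ltnn.
rewrite /p; case: (leqP m t) => mt.
  by left; rewrite !(minn_idPr _) // leqW.
(* While [t < m], legs [t] and [t.+1] differ, so the move follows a rung. *)
right; right; rewrite /= !eqxx !andbT (minn_idPl mt).
apply/eqP => /(congr1 val); rewrite /= !inordK ?ltnS // ?(ltnW mt) //.
by move/eqP; rewrite eqn_leq ltnn andbF.
Qed.

Lemma web_can_contain_gt0 m d k : can_contain (web m) d None k -> 0 < k.
Proof.
case: k => // -[p [_ [t ct]]]; exfalso; move: ct.
apply: (free_leg_not_contained (spider_subgraph_web m) (subgraph_refl _) p
  ord0).
by move=> a s [s' [[i lt_i0] _]].
Qed.

Local Open Scope ring_scope.

Theorem theorem2p1 (R : realType) (N : R) :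
  exists (T : Type) (G H : graph T) (u : T),
    [/\ subgraph H G, vertices H u &
      forall d : nat, (0 < d)%N ->
        exists fG fH : nat,
          [/\ firefighter_number G d u fG,
              firefighter_number H d u fH,
              (0 < fG)%N,
              N <= fH%:R - fG%:R :> R &
              N <= fH%:R / fG%:R :> R]].
Proof.
(* The two numbers will be [m.+1] and 1, with difference [m] and ratio [m.+1], so [N <= m] is
   enough. *)
pose m := Num.bound `|N|.
have Nm : N <= m%:R.
  by rewrite (le_trans (ler_norm N)) // ltW // archi_boundP.
exists (spider_vertex m), (web m), (spider m), None; split=> // [|d d0].
  exact: spider_subgraph_web.
exists 1%N, m.+1; split=> //.
- by split; [exact: web_can_contain|exact: web_can_contain_gt0].
- by split; [exact: spider_can_contain|exact: spider_can_contain_gt].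
- by rewrite -natrB // subn1.
- by rewrite divr1 (le_trans Nm) // ler_nat.
Qed.
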